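(* Let $C$ be a bounded chain complex of $\underline{\mathbb Z/2}$-modules which in each degree is a finite direct sum of copies of $F$ and $H$. Then $C$ is isomorphic (as a chain complex) to a finite direct sum of shifts of the complexes $A_k$, $B_r$, $H(n)$ (for various $k,r\geq 0$ and $n\in\mathbb Z$) and the contractible complexes $\mathbb D(F)$ and $\mathbb D(H)$.
   Context: A $C_2$-Mackey functor $M$ consists of abelian groups $M_\Theta,M_\bullet$ and homomorphisms $t\colon M_\Theta\to M_\Theta$, $p^*\colon M_\bullet\to M_\Theta$, $p_*\colon M_\Theta\to M_\bullet$ with $tp^*=p^*$, $p_*t=p_*$, $t^2=1$, $p^*p_*=1+t$. A $\underline{\mathbb Z/2}$-module (module over the constant Mackey ring $\underline{\mathbb Z/2}$) is the same thing as a Mackey functor in which $M_\Theta,M_\bullet$ are $\mathbb F_2$-vector spaces and $p_*p^*=0$. Let $H=\underline{\mathbb Z/2}$ (both groups $\mathbb F_2$, $t=p^*=\mathrm{id}$, $p_*=0$) and let $F$ be the module with $F_\Theta=\mathbb F_2^2$, $t$ swapping the coordinates, $F_\bullet=\mathbb F_2$, $p_*(x,y)=x+y$, $p^*(z)=(z,z)$. The nonzero maps between these are: the unique nonzero map $p\colon F\to H$, the unique nonzero map $p\colon H\to F$, $\mathrm{id}_H$, and $1,t,u:=1+t\colon F\to F$. Chain complexes are homologically graded (differentials lower degree); $\Sigma$ denotes the shift $(\Sigma C)_i=C_{i-1}$. Define: for $k\geq 0$, $A_k$ is $F\xrightarrow{u}F\xrightarrow{u}\cdots\xrightarrow{u}F$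 with $F$ in degrees $k,\dots,0$; $H(0)$ is $H$ in degree $0$; for $n>0$, $H(-n)$ is $H\xrightarrow{p}F\xrightarrow{u}\cdots\xrightarrow{u}F$ with $H$ in degree $n$ and $F$ in degrees $n-1,\dots,0$; for $n>0$, $H(n)$ is $F\xrightarrow{u}\cdots\xrightarrow{u}F\xrightarrow{p}H$ with $F$ in degrees $0,\dots,-(n-1)$ and $H$ in degree $-n$; for $r\geq 0$, $B_r$ is $H\xrightarrow{p}F\xrightarrow{u}\cdots\xrightarrow{u}F\xrightarrow{p}H$ with $H$ in degree $0$, $F$ in degrees $-1,\dots,-(r+1)$, and $H$ in degree $-(r+2)$. For a module $P$, $\mathbb D(P)$ is the complex $P\xrightarrow{\mathrm{id}}P$ concentrated in degrees $1$ and $0$. *)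

(* Defs.v *)
(* Z/2-modules (modules over the constant Mackey ring Z/2)
   with finite-dimensional underlying F_2-vector spaces, encoded by matrices
   over 'F_2 acting on ROW vectors (a linear map V -> W is x |-> x *m A). *)
From HB Require Import structures.
From mathcomp Require Import all_boot all_order all_algebra.
Set Implicit Arguments. Unset Strict Implicit. Unset Printing Implicit Defensive.
Import Order.TTheory GRing.Theory Num.Theory.
Local Open Scope ring_scope.

(* A C2-Mackey functor with M_Theta = F_2^dT, M_bullet = F_2^dB.
   tm = t, ps = p^* : M_bullet -> M_Theta, pl = p_* : M_Theta -> M_bullet. *)
Record mod := Mod {
  dT : nat; dB : nat;
  tm : 'M['F_2]_dT;
  ps : 'M['F_2]_(dB, dT);
  pl : 'M['F_2]_(dT, dB) }.

(* Mackey functor axioms (t p^* = p^*, p_* t = p_*, t^2 = 1, p^* p_* = 1 + t)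
   together with the Z/2-module condition p_* p^* = 0 (2 = 0 is automatic
   over F_2).  In row convention "g o f" is "f *m g". *)
Definition is_mod (M : mod) : Prop :=
  [/\ ps M *m tm M = ps M,
      tm M *m pl M = pl M,
      tm M *m tm M = 1%:M,
      pl M *m ps M = 1%:M + tm M
    & ps M *m pl M = 0].

Record mor (M N : mod) := Mor {
  mT : 'M['F_2]_(dT M, dT N);
  mB : 'M['F_2]_(dB M, dB N) }.

Definition is_mor (M N : mod) (f : mor M N) : Prop :=
  [/\ tm M *m mT f = mT f *m tm N,
      ps M *m mT f = mB f *m ps N
    & pl M *m mB f = mT f *m pl N].

Definition comp (M N P : mod) (f : mor M N) (g : mor N P) : mor M P :=
  @Mor M P (mT f *m mT g) (mB f *m mB g).
Definition idm (M : mod) : mor M M := @Mor M M 1%:M 1%:M.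
Definition zmor (M N : mod) : mor M N := @Mor M N 0 0.

Definition mod_iso (M N : mod) : Prop :=
  exists (f : mor M N) (g : mor N M),
    [/\ is_mor f, is_mor g, comp f g = idm M & comp g f = idm N].

Definition mod0 : mod := @Mod 0 0 0 0 0.
Definition dsum (M N : mod) : mod :=
  @Mod (dT M + dT N) (dB M + dB N)
       (block_mx (tm M) 0 0 (tm N))
       (block_mx (ps M) 0 0 (ps N))
       (block_mx (pl M) 0 0 (pl N)).
Definition morsum (M M' N N' : mod) (f : mor M M') (g : mor N N') :
  mor (dsum M N) (dsum M' N') :=
  @Mor (dsum M N) (dsum M' N') (block_mx (mT f) 0 0 (mT g))
                               (block_mx (mB f) 0 0 (mB g)).
Definition msum (s : seq mod) : mod := foldr dsum mod0 s.

Definition modH : mod := @Mod 1 1 1%:M 1%:M 0.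
Definition tF : 'M['F_2]_2 := \matrix_(i < 2, j < 2) (i != j)%:R.
Definition modF : mod := @Mod 2 1 tF (const_mx 1) (const_mx 1).

(* the maps p : F -> H, p : H -> F, u = 1 + t : F -> F *)
Definition pFH : mor modF modH := @Mor modF modH (const_mx 1) 0.
Definition pHF : mor modH modF := @Mor modH modF (const_mx 1) (const_mx 1).
Definition uF  : mor modF modF := @Mor modF modF (const_mx 1) 0.

(* Chain complexes (homological grading).  dif i j is the component
   C_i -> C_j of the differential; it is required to vanish unless j = i - 1.
   This encoding avoids transports along i - 1 - n = i - n - 1. *)
Record cx := Cx {
  obj : int -> mod;
  dif : forall i j : int, mor (obj i) (obj j) }.

Definition is_cx (C : cx) : Prop :=
  [/\ forall i, is_mod (obj C i),
      forall i j, is_mor (dif C i j),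
      forall i j, j != i - 1 -> dif C i j = zmor _ _
    & forall i j k, comp (dif C i j) (dif C j k) = zmor _ _].

Definition bounded (C : cx) : Prop :=
  exists N : nat, forall i : int, (N < absz i)%N ->
    dT (obj C i) = 0%N /\ dB (obj C i) = 0%N.

Definition cx_iso (C D : cx) : Prop :=
  exists (f : forall i, mor (obj C i) (obj D i))
         (g : forall i, mor (obj D i) (obj C i)),
    (forall i, [/\ is_mor (f i), is_mor (g i),
                   comp (f i) (g i) = idm _ & comp (g i) (f i) = idm _]) /\
    (forall i j, comp (dif C i j) (f j) = comp (f i) (dif D i j)).

Definition cx0 : cx := @Cx (fun _ => mod0) (fun _ _ => zmor _ _).
Definition cxsum (C D : cx) : cx :=
  @Cx (fun i => dsum (obj C i) (obj D i))
      (fun i j => morsum (dif C i j) (dif D i j)).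
Definition cxbig (s : seq cx) : cx := foldr cxsum cx0 s.
Definition shift (n : int) (C : cx) : cx :=
  @Cx (fun i => obj C (i - n)) (fun i j => dif C (i - n) (j - n)).

Inductive lab := LF | LH | LZ.
Definition modOf (a : lab) : mod :=
  match a with LF => modF | LH => modH | LZ => mod0 end.
Definition lmor (useU : bool) (a b : lab) : mor (modOf a) (modOf b) :=
  match a as a0, b as b0 return mor (modOf a0) (modOf b0) with
  | LF, LF => if useU then uF else idm modF
  | LF, LH => pFH
  | LH, LF => pHF
  | LH, LH => idm modH
  | _, _ => zmor _ _
  end.
Definition stdcx (useU : bool) (o : int -> lab) : cx :=
  @Cx (fun i => modOf (o i))
      (fun i j => if j == i - 1 then lmor useU (o i) (o j) else zmor _ _).

Definition cxA (k : nat) : cx :=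
  stdcx true (fun i => if (0 <= i) && (i <= k%:Z) then LF else LZ).
(* H(m), m : int.  H(0) = H in degree 0;
   m = -n < 0 : H in degree n, F in degrees n-1..0;
   m = n > 0 : F in degrees 0..-(n-1), H in degree -n. *)
Definition cxH (m : int) : cx :=
  stdcx true (fun i =>
    if i == - m then LH
    else if ((0 <= i) && (i < - m)) || ((- m < i) && (i <= 0)) then LF
    else LZ).
Definition cxB (r : nat) : cx :=
  stdcx true (fun i =>
    if (i == 0) || (i == - (r%:Z + 2)) then LH
    else if (- (r%:Z + 1) <= i) && (i <= -1) then LF
    else LZ).
Definition cxD (a : lab) : cx :=
  stdcx false (fun i => if (i == 0) || (i == 1) then a else LZ).

Inductive piece := PA of nat | PB of nat | PHn of int | PDF | PDH.
Definition pieceCx (p : piece) : cx :=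
  match p with
  | PA k => cxA k | PB r => cxB r | PHn m => cxH m
  | PDF => cxD LF | PDH => cxD LH
  end.

Definition FHsum (s : seq bool) : mod :=
  msum [seq (if b then modF else modH) | b <- s].

(* Main.v *)
(* Finite sums of [F] and [H] are exactly the fixed-point functors, those for
   which p^* identifies M_bullet with the t-invariants of M_Theta.  Hence C is
   determined by its Theta-part, a bounded complex V of finite-dimensional
   F_2[C_2]-modules, and any direct summand of V is again of that kind: it
   suffices to split off one elementary piece at a time and to induct on the
   total dimension.  Write u = 1 + t, so that u^2 = 0.

   If w u d <> 0, then w and w d generate a copy of D(F), which splits because
   F_2[u, d] / (u^2, d^2) is self-injective.  Otherwise u d = 0; let n be the top
   degree and follow zigzags w_n d = w_{n-1} u, w_{n-1} d = w_{n-2} u, ... from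
   a w_n with w_n u <> 0 (from any w_n <> 0 if u = 0 in degree n).  The shortest
   zigzag that dies (w_{n-m} d = 0) spans a copy of A_m or H(-m).  If none dies,
   a longest one, completed by the class w_{n-m} d, spans a copy of H(m+1),
   B_{m-1} or D(H).  Extremality of m is exactly what is needed to extend, degree
   by degree downwards, a functional that is nonzero on the start of the zigzag
   to a dual zigzag of functionals, and this provides the retraction. *)
Require Import Defs.
From mathcomp Require Import all_boot all_order all_algebra.
From mathcomp Require Import zify.
Set Implicit Arguments. Unset Strict Implicit. Unset Printing Implicit Defensive.
Import Order.TTheory GRing.Theory Num.Theory.
Local Open Scope ring_scope.

(** * Modules whose bullet part is the invariants of the Theta part *)

Lemma addmm (m n : nat) (A : 'M['F_2]_(m, n)) : A + A = 0.
Proof.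
apply/matrixP => i j; rewrite !mxE; apply/val_inj.
by case: (A i j) => [[|[|k]] h].
Qed.

(** [A] is a whole matrix of invariant rows, so the factorization through [ps] applies directly to
    composites of maps. *)
Definition fixed (M : mod) : Prop :=
  [/\ is_mod M, row_free (ps M)
    & forall m (A : 'M_(m, dT M)), A *m tm M = A -> (A <= ps M)%MS].

Lemma fixedI (M : mod) (r : 'M_(dT M, dB M)) :
  is_mod M -> ps M *m r = 1%:M ->
  (forall m (A : 'M_(m, dT M)), A *m tm M = A -> A *m r *m ps M = A) ->
  fixed M.
Proof.
move=> hM hr hA; split=> //; first by apply/row_freeP; exists r.
by move=> m A /hA <-; rewrite submxMl.
Qed.

Lemma fixed_mod0 : fixed mod0.
Proof.
apply: (@fixedI mod0 0) => [|| m A _]; first split;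
  by apply/matrixP => -[i hi] -[j hj].
Qed.

Lemma fixed_modH : fixed modH.
Proof.
apply: (@fixedI modH 1%:M) => [|| m A _]; rewrite /= ?mulmx1 //.
by split; rewrite /= ?mulmx1 ?mulmx0 ?mul1mx ?mul0mx // addmm.
Qed.

(* The dimension of [modF] is the literal [2], not [1 + 1]: the block identities
   are restated at that type so that they can be used for rewriting. *)
Section Size2.
Variable K : comNzRingType.
Implicit Types (a b c d : 'M[K]_1) (m n : nat).

Lemma mul_col2 n m (A B : 'rV_n) (C : 'M[K]_(n, m)) :
  (col_mx A B : 'M_(2, n)) *m C = (col_mx (A *m C) (B *m C) : 'M_(2, m)).
Proof. exact: (mul_col_mx A B C). Qed.

Lemma mul_row2 n m (A B : 'cV_n) (C : 'M[K]_(m, n)) :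
  C *m (row_mx A B : 'M_(n, 2)) = (row_mx (C *m A) (C *m B) : 'M_(m, 2)).
Proof. exact: (mul_mx_row C A B). Qed.

Lemma mul_row2_block m (A B : 'cV_m) a b c d :
  (row_mx A B : 'M_(m, 2)) *m (block_mx a b c d : 'M_2) =
  (row_mx (A *m a + B *m c) (A *m b + B *m d) : 'M_(m, 2)).
Proof. exact: (mul_row_block A B a b c d). Qed.

Lemma mul_block_col2 m (A B : 'rV_m) a b c d :
  (block_mx a b c d : 'M_2) *m (col_mx A B : 'M_(2, m)) =
  (col_mx (a *m A + b *m B) (c *m A + d *m B) : 'M_(2, m)).
Proof. exact: (mul_block_col a b c d A B). Qed.

Lemma mul_row2_col m n (A B : 'cV_m) (C D : 'rV[K]_n) :
  (row_mx A B : 'M_(m, 2)) *m (col_mx C D : 'M_(2, n)) = A *m C + B *m D.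
Proof. exact: (mul_row_col A B C D). Qed.

Lemma mul_col2_row2 m (A B : 'rV[K]_m) (C D : 'cV_m) :
  (col_mx A B : 'M_(2, m)) *m (row_mx C D : 'M_(m, 2)) =
  (block_mx (A *m C) (A *m D) (B *m C) (B *m D) : 'M_2).
Proof. exact: (mul_col_row A B C D). Qed.

Lemma mulmx_block2 a b c d a' b' c' d' :
  (block_mx a b c d : 'M_2) *m (block_mx a' b' c' d' : 'M_2) =
  (block_mx (a *m a' + b *m c') (a *m b' + b *m d')
            (c *m a' + d *m c') (c *m b' + d *m d') : 'M_2).
Proof. exact: (mulmx_block a b c d a' b' c' d'). Qed.

Lemma block2_1 : 1%:M = @block_mx K 1 1 1 1 1%:M 0 0 1%:M :> 'M_2.
Proof. exact: (scalar_mx_block 1 1). Qed.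

Lemma add_block2 a b c d a' b' c' d' :
  (block_mx a b c d : 'M_2) + (block_mx a' b' c' d' : 'M_2) =
  (block_mx (a + a') (b + b') (c + c') (d + d') : 'M_2).
Proof. exact: (add_block_mx a b c d a' b' c' d'). Qed.

End Size2.

Lemma const1_col : const_mx 1 = @col_mx 'F_2 1 1 1 1%:M 1%:M :> 'M_(2, 1).
Proof.
by rewrite -[1%:M](_ : const_mx 1 = _) ?col_mx_const //
  [RHS]mx11_scalar [LHS]mx11_scalar !mxE.
Qed.

Lemma const1_row : const_mx 1 = @row_mx 'F_2 1 1 1 1%:M 1%:M :> 'M_(1, 2).
Proof.
by rewrite -[1%:M](_ : const_mx 1 = _) ?row_mx_const //
  [RHS]mx11_scalar [LHS]mx11_scalar !mxE.
Qed.

Lemma const1_block :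
  const_mx 1 = @block_mx 'F_2 1 1 1 1 1%:M 1%:M 1%:M 1%:M :> 'M_2.
Proof.
rewrite -[1%:M](_ : const_mx 1 = _) ?block_mx_const //.
by rewrite [RHS]mx11_scalar [LHS]mx11_scalar !mxE.
Qed.

Lemma tF_block : tF = @block_mx 'F_2 1 1 1 1 0 1%:M 1%:M 0 :> 'M_2.
Proof.
apply/matrixP => i j; rewrite !mxE -val_eqE /=.
by case: splitP => k ->; rewrite mxE; case: splitP => l ->;
  rewrite !mxE (ord1 k) (ord1 l).
Qed.

Lemma fixed_modF : fixed modF.
Proof.
apply: (@fixedI modF (@col_mx 'F_2 1 1 1 1%:M 0)) => [||m A];
  rewrite /= ?const1_col ?const1_row ?tF_block.
- split; rewrite /= ?const1_col ?const1_row ?tF_block.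
  + by rewrite mul_row2_block !mulmx0 !mulmx1 add0r addr0.
  + by rewrite mul_block_col2 !mul0mx !mul1mx add0r addr0.
  + by rewrite mulmx_block2 !(mul0mx, mul1mx, mulmx0, addr0, add0r) block2_1.
  + by rewrite mul_col2_row2 !mul1mx block2_1 add_block2 !addr0 !add0r.
  + by rewrite mul_row2_col !mul1mx addmm.
- by rewrite mul_row2_col mulmx1 mulmx0 addr0.
- rewrite -[A](@hsubmxK _ m 1 1); set A1 := lsubmx _; set A2 := rsubmx _.
  rewrite mul_row2_block !mulmx0 !mulmx1 add0r addr0.
  case/(@eq_row_mx _ m 1 1) => e1 e2.
  by rewrite mul_row2_col mulmx1 mulmx0 addr0 mul_row2 !mulmx1 e2.
Qed.

Lemma fixed_modOf (a : lab) : fixed (modOf a).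
Proof. by case: a; [exact: fixed_modF|exact: fixed_modH|exact: fixed_mod0]. Qed.

Lemma fixed_dsum (M N : mod) : fixed M -> fixed N -> fixed (dsum M N).
Proof.
case=> [[M1 M2 M3 M4 M5] Mf Ms] [[N1 N2 N3 N4 N5] Nf Ns].
apply: (@fixedI (dsum M N) (block_mx (pinvmx (ps M)) 0 0 (pinvmx (ps N)))) => /=.
- split; rewrite /= mulmx_block !mul0mx !mulmx0 ?addr0 ?add0r.
  + by rewrite M1 N1.
  + by rewrite M2 N2.
  + by rewrite M3 N3 -scalar_mx_block.
  + by rewrite M4 N4 scalar_mx_block add_block_mx !addr0.
  + by rewrite M5 N5 block_mx0.
- rewrite mulmx_block !mul0mx !mulmx0 ?addr0 ?add0r !mulmxVp //.
  by rewrite -scalar_mx_block.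
- move=> m A; rewrite -[A]hsubmxK !mul_row_block !mulmx0 ?addr0 ?add0r.
  by case/eq_row_mx => /Ms sM /Ns sN; rewrite !mulmxKpV.
Qed.

Lemma fixed_FHsum (s : seq bool) : fixed (FHsum s).
Proof.
elim: s => [|b s IH]; first exact: fixed_mod0.
by apply: fixed_dsum => //; case: b; [exact: fixed_modF|exact: fixed_modH].
Qed.

Lemma fixed_iso (M N : mod) : is_mod M -> mod_iso M N -> fixed N -> fixed M.
Proof.
move=> hM [f [g [[f1 f2 f3] [g1 g2 g3] [e1 e2] [e3 e4]]]] [hN Nf Ns].
apply: (@fixedI M (mT f *m pinvmx (ps N) *m mB g)) => // [|m A hA].
  by rewrite 2!mulmxA f2 -(mulmxA (mB f)) mulmxVp // mulmx1 e2.
have sA : (A *m mT f <= ps N)%MS by apply: Ns; rewrite -mulmxA -f1 mulmxA hA.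
by rewrite 2!mulmxA -(mulmxA _ (mB g)) -g2 mulmxA mulmxKpV // -mulmxA e1 mulmx1.
Qed.

(* [mT] is a full and faithful functor on fixed-point modules, with values in
   the representations of C_2; [ext] is the inverse on morphisms. *)
Definition ext (M N : mod) (A : 'M_(dT M, dT N)) : mor M N :=
  Mor A (ps M *m A *m pinvmx (ps N)).

(** The rows of [ps M *m A] are invariant, hence factor through [ps N]. Compatibility with p_* is
    tested after the injective p^* of [N], where p^* p_* = 1 + t and [A] commutes with t. *)
Lemma is_mor_ext (M N : mod) (A : 'M_(dT M, dT N)) :
  is_mod M -> fixed N -> tm M *m A = A *m tm N -> is_mor (ext A).
Proof.
move=> [M1 M2 M3 M4 M5] [[N1 N2 N3 N4 N5] Nf Ns] hA.
have e : ps M *m A = ps M *m A *m pinvmx (ps N) *m ps N.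
  by rewrite mulmxKpV //; apply: Ns; rewrite -mulmxA -hA mulmxA M1.
split=> //=; apply: (row_free_inj Nf).
rewrite -(mulmxA (pl M)) -e mulmxA M4 -mulmxA N4 mulmxDr mulmxDl.
by rewrite hA mulmx1 mul1mx.
Qed.

Lemma mor_eq (M N : mod) (f g : mor M N) :
  fixed N -> is_mor f -> is_mor g -> mT f = mT g -> f = g.
Proof.
case: f g => [fT fB] [gT gB] [_ Nf _] [/= _ f2 _] [/= _ g2 _] /= e.
move: f2; rewrite e g2 => /(row_free_inj Nf) e2.
by rewrite e2.
Qed.

Lemma is_mor_comp (M N P : mod) (f : mor M N) (g : mor N P) :
  is_mor f -> is_mor g -> is_mor (Defs.comp f g).
Proof.
move=> [f1 f2 f3] [g1 g2 g3]; split=> /=.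
- by rewrite mulmxA f1 -mulmxA g1 mulmxA.
- by rewrite mulmxA f2 -mulmxA g2 mulmxA.
- by rewrite mulmxA f3 -mulmxA g3 mulmxA.
Qed.

Lemma is_mor_idm (M : mod) : is_mor (idm M).
Proof. by split; rewrite /= mulmx1 mul1mx. Qed.

Lemma is_mor_zmor (M N : mod) : is_mor (zmor M N).
Proof. by split; rewrite /= mulmx0 mul0mx. Qed.

Lemma is_mor_morsum (M M' N N' : mod) (f : mor M M') (g : mor N N') :
  is_mor f -> is_mor g -> is_mor (morsum f g).
Proof.
move=> [f1 f2 f3] [g1 g2 g3].
by split; rewrite /= !mulmx_block !mul0mx !mulmx0 !addr0 !add0r;
  congr block_mx.
Qed.

Lemma is_mor_lmor (b : bool) (a a' : lab) : is_mor (lmor b a a').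
Proof.
have simp := (mul0mx, mulmx0, mul1mx, mulmx1, add0r, addr0).
case: a; case: a'; rewrite /lmor; try exact: is_mor_zmor; try exact: is_mor_idm.
- case: b; last exact: is_mor_idm.
  split; rewrite /= ?const1_block ?const1_col ?const1_row ?tF_block.
  + by rewrite !mulmx_block2 !simp.
  + by rewrite mul_row2_block !simp addmm [LHS](@row_mx0 _ 1 1 1).
  + by rewrite mul_block_col2 !simp addmm [RHS](@col_mx0 _ 1 1 1).
- split; rewrite /= ?const1_block ?const1_col ?const1_row ?tF_block.
  + by rewrite mul_block_col2 !simp.
  + by rewrite mul_row2_col !simp addmm.
  + by rewrite !simp.
- split; rewrite /= ?const1_block ?const1_col ?const1_row ?tF_block.
  + by rewrite mul_row2_block !simp.
  + by rewrite [const_mx 1]mx11_scalar mxE.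
  + by rewrite mul_row2_col !simp addmm.
Qed.

(** * Reduction to complexes of representations of C_2 *)

Record tcx := Tcx {
  dm : int -> nat;
  tt : forall i, 'M['F_2]_(dm i);
  dd : forall i j, 'M['F_2]_(dm i, dm j) }.

Definition is_tcx (V : tcx) : Prop :=
  [/\ forall i, tt V i *m tt V i = 1%:M,
      forall i j, tt V i *m dd V i j = dd V i j *m tt V j,
      forall i j, j != i - 1 -> dd V i j = 0
    & forall i j k, dd V i j *m dd V j k = 0].

Definition tcx_map (V W : tcx) (f : forall i, 'M['F_2]_(dm V i, dm W i)) : Prop :=
  (forall i, tt V i *m f i = f i *m tt W i) /\
  (forall i j, dd V i j *m f j = f i *m dd W i j).

Definition tcx_iso (V W : tcx) : Prop :=
  exists f g, [/\ @tcx_map V W f, @tcx_map W V g,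
    forall i, f i *m g i = 1%:M & forall i, g i *m f i = 1%:M].

Definition tsum (V W : tcx) : tcx :=
  @Tcx (fun i => (dm V i + dm W i)%N)
       (fun i => block_mx (tt V i) 0 0 (tt W i))
       (fun i j => block_mx (dd V i j) 0 0 (dd W i j)).

Definition theta (C : cx) : tcx :=
  @Tcx (fun i => dT (obj C i)) (fun i => tm (obj C i))
       (fun i j => mT (dif C i j)).

Definition cx_fixed (C : cx) : Prop :=
  (forall i, fixed (obj C i)) /\ (forall i j, is_mor (dif C i j)).

Lemma cx_fixed0 : cx_fixed cx0.
Proof. by split=> *; [exact: fixed_mod0|exact: is_mor_zmor]. Qed.

Lemma cx_fixed_sum (C D : cx) : cx_fixed C -> cx_fixed D -> cx_fixed (cxsum C D).
Proof.
move=> [C1 C2] [D1 D2]; split=> *; first exact: fixed_dsum.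
exact: is_mor_morsum.
Qed.

Lemma cx_fixed_shift (n : int) (C : cx) : cx_fixed C -> cx_fixed (shift n C).
Proof. by case=> C1 C2; split=> *; [exact: C1|exact: C2]. Qed.

Lemma cx_fixed_std (b : bool) (o : int -> lab) : cx_fixed (stdcx b o).
Proof.
split=> [i|i j] /=; first exact: fixed_modOf.
by case: ifP => _; [exact: is_mor_lmor|exact: is_mor_zmor].
Qed.

Lemma cx_fixed_piece (p : piece) : cx_fixed (pieceCx p).
Proof. by case: p => *; exact: cx_fixed_std. Qed.

Lemma cx_fixed_big (s : seq (piece * int)) :
  cx_fixed (cxbig [seq shift x.2 (pieceCx x.1) | x <- s]).
Proof.
elim: s => [|x s IH] /=; first exact: cx_fixed0.
exact: cx_fixed_sum (cx_fixed_shift _ (cx_fixed_piece _)) IH.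
Qed.

Lemma cx_iso_theta (C D : cx) :
  cx_fixed C -> cx_fixed D -> tcx_iso (theta C) (theta D) -> cx_iso C D.
Proof.
move=> [C1 C2] [D1 D2] [f [g [[f1 f2] [g1 g2] fg gf]]].
have hf i : is_mor (ext (f i)).
  by apply: is_mor_ext; [case: (C1 i)|exact: D1|exact: f1].
have hg i : is_mor (ext (g i)).
  by apply: is_mor_ext; [case: (D1 i)|exact: C1|exact: g1].
exists (fun i => ext (f i)), (fun i => ext (g i)); split=> [i|i j].
  split=> //; (apply: mor_eq; [by []|exact: is_mor_comp|exact: is_mor_idm|]).
  - exact: fg.
  - exact: gf.
apply: mor_eq; [exact: D1|exact: is_mor_comp|exact: is_mor_comp|exact: f2].
Qed.

(** * Isomorphisms and direct summands of such complexes *)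

Lemma tcx_map_comp (V W X : tcx) f g :
  @tcx_map V W f -> @tcx_map W X g -> @tcx_map V X (fun i => f i *m g i).
Proof.
move=> [f1 f2] [g1 g2]; split=> [i|i j].
- by rewrite mulmxA f1 -mulmxA g1 mulmxA.
- by rewrite mulmxA f2 -mulmxA g2 mulmxA.
Qed.

Lemma tcx_iso_trans (V W X : tcx) : tcx_iso V W -> tcx_iso W X -> tcx_iso V X.
Proof.
move=> [f [f' [hf hf' e1 e2]]] [g [g' [hg hg' e3 e4]]].
exists (fun i => f i *m g i), (fun i => g' i *m f' i).
split=> [||i|i]; try exact: tcx_map_comp.
- by rewrite mulmxA -(mulmxA (f i)) e3 mulmx1.
- by rewrite mulmxA -(mulmxA (g' i)) e2 mulmx1.
Qed.

Lemma tcx_iso_sum (P V W : tcx) : tcx_iso V W -> tcx_iso (tsum P V) (tsum P W).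
Proof.
move=> [f [g [[f1 f2] [g1 g2] e1 e2]]].
exists (fun i => block_mx 1%:M 0 0 (f i)), (fun i => block_mx 1%:M 0 0 (g i)).
have simp := (mulmx_block, mul0mx, mulmx0, mul1mx, mulmx1, add0r, addr0).
split=> [||i|i] /=; try split=> [i|i j] /=; rewrite !simp.
- by rewrite f1.
- by rewrite f2.
- by rewrite g1.
- by rewrite g2.
- by rewrite e1 -scalar_mx_block.
- by rewrite e2 -scalar_mx_block.
Qed.

(** Normalizing [rho] gives a retraction [q] of [iota]; then [e = 1 - q iota] is an idempotent
    endomorphism of the complex, and its image is the complement [W]. *)
Lemma tcx_split (V P : tcx) iota rho :
  is_tcx V -> @tcx_map P V iota -> @tcx_map V P rho ->
  (forall i, iota i *m rho i \in unitmx) ->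
  exists W, [/\ is_tcx W, tcx_iso V (tsum P W)
              & forall i, dm V i = (dm P i + dm W i)%N].
Proof.
move=> [V1 V2 V3 V4] hi hr0 hu.
have [i1 i2] := hi.
have [q [[q1 q2] hq]] : exists q, @tcx_map V P q /\ forall i, iota i *m q i = 1%:M.
  have [s1 s2] := tcx_map_comp hi hr0.
  exists (fun i => rho i *m invmx (iota i *m rho i)).
  split=> [|i]; last by rewrite mulmxA mulmxV.
  apply: (tcx_map_comp hr0); split=> [i|i j].
  - by rewrite -[LHS](mulKmx (hu i)) (mulmxA (iota i *m rho i)) -s1
      -(mulmxA _ (iota _ *m rho _)) mulmxV // mulmx1.
  - by rewrite -[LHS](mulKmx (hu i)) (mulmxA (iota i *m rho i)) -s2
      -(mulmxA _ (iota _ *m rho _)) mulmxV // mulmx1.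
pose e i := 1%:M - q i *m iota i.
have qe i : e i *m q i = 0.
  by rewrite mulmxBl mul1mx -mulmxA hq mulmx1 subrr.
have ie i : iota i *m e i = 0.
  by rewrite mulmxBr mulmx1 mulmxA hq mul1mx subrr.
have ee i : e i *m e i = e i.
  by rewrite {1}/e mulmxBl mul1mx -mulmxA ie mulmx0 subr0.
have et i : tt V i *m e i = e i *m tt V i.
  by rewrite mulmxBl mulmxBr mulmx1 mul1mx mulmxA q1 -mulmxA i1 mulmxA.
have ed i j : dd V i j *m e j = e i *m dd V i j.
  by rewrite mulmxBl mulmxBr mulmx1 mul1mx mulmxA q2 -mulmxA i2 mulmxA.
(* The rows of [k i] are a basis of the image of [e i], and [p i] gives the coordinates of the
   projection in it; the structure of [W] is transported along both. *)
pose k i := row_base (e i).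
pose p i := e i *m pinvmx (k i).
have pk i : p i *m k i = e i by rewrite mulmxKpV // eq_row_base.
have ke i : k i *m e i = k i.
  have /submxP[x ->] : (k i <= e i)%MS by rewrite eq_row_base.
  by rewrite -mulmxA ee.
have kp i : k i *m p i = 1%:M.
  by rewrite mulmxA ke mulmxVp // row_base_free.
have kq i : k i *m q i = 0 by rewrite -ke -mulmxA qe mulmx0.
have ip i : iota i *m p i = 0 by rewrite mulmxA ie mul0mx.
have ep i : e i *m p i = p i by rewrite mulmxA ee.
clearbody p k.
pose W := @Tcx (fun i => \rank (e i)) (fun i => k i *m tt V i *m p i)
               (fun i j => k i *m dd V i j *m p j).
have kt i : k i *m tt V i = k i *m tt V i *m p i *m k i.
  by rewrite -!mulmxA pk et mulmxA ke.
have kd i j : k i *m dd V i j = k i *m dd V i j *m p j *m k j.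
  by rewrite -!mulmxA pk ed mulmxA ke.
have tp i : tt V i *m p i = p i *m (k i *m tt V i *m p i).
  by rewrite !mulmxA pk -et -(mulmxA _ (e i)) ep.
have dp i j : dd V i j *m p j = p i *m (k i *m dd V i j *m p j).
  by rewrite !mulmxA pk -ed -(mulmxA _ (e j)) ep.
have qk i : row_mx (q i) (p i) *m col_mx (iota i) (k i) = 1%:M.
  by rewrite mul_row_col pk addrC subrK.
have kk i : col_mx (iota i) (k i) *m row_mx (q i) (p i) = 1%:M.
  by rewrite mul_col_row hq kq kp ip -scalar_mx_block.
exists W; split.
- split=> [i|i j|i j|i j l] /=.
  + by rewrite !mulmxA -kt -(mulmxA (k i)) V1 mulmx1 kp.
  + by rewrite !mulmxA -kt -kd -(mulmxA (k i)) V2 !mulmxA.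
  + by move/V3->; rewrite mulmx0 mul0mx.
  + by rewrite !mulmxA -kd -(mulmxA (k i)) V4 mulmx0 mul0mx.
- exists (fun i => row_mx (q i) (p i)), (fun i => col_mx (iota i) (k i)).
  have simp := (mul_row_block, mul_block_col, mul_mx_row, mul_col_mx,
    mulmx0, mul0mx, addr0, add0r).
  split; [| |exact: qk|exact: kk]; split=> [i|i j] /=; rewrite !simp.
  + by rewrite q1 tp.
  + by rewrite q2 dp.
  + by rewrite i1 -kt.
  + by rewrite i2 -kd.
(* Mutually inverse matrices force equal dimensions, by comparing ranks. *)
- move=> i; have := mxrank1 'F_2 (dm V i); rewrite -(qk i) => h.
  apply/eqP; rewrite eqn_leq -{1}h (leq_trans (mxrankM_maxl _ _)) ?rank_leq_col //=.
  rewrite -{1}(mxrank1 'F_2 (dm P i + \rank (e i))) -(kk i).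
  by rewrite (leq_trans (mxrankM_maxl _ _)) ?rank_leq_col.
Qed.

(** * Elementary complexes described by vectors and covectors *)

(* A morphism from [modOf a] is determined by one vector [w] (a generator, which
   must be invariant if [a = LH]), a morphism to [modOf a] by one covector [b]. *)
Definition gen (a : lab) n (t : 'M['F_2]_n) (w : 'rV_n) : 'M_(dT (modOf a), n) :=
  match a with LF => col_mx w (w *m t) | LH => w | LZ => 0 end.

Definition cogen (a : lab) n (t : 'M['F_2]_n) (b : 'cV_n) : 'M_(n, dT (modOf a)) :=
  match a with LF => row_mx (t *m b) b | LH => b | LZ => 0 end.

(** Tells whether the [lmor] arrow between F and [a] contributes a factor u: always if [a] is H, and
    for F exactly when the arrow is u rather than the identity. *)
Definition labF (b : bool) (a : lab) : bool :=
  b || (if a is LH then true else false).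

Section Gen.
Variables (n : nat) (t : 'M['F_2]_n).
Hypothesis tt1 : t *m t = 1%:M.
Let u := 1%:M + t.

Lemma mulu m (w : 'M_(m, n)) : w *m u = w + w *m t.
Proof. by rewrite mulmxDr mulmx1. Qed.

Lemma umul m (w : 'M_(n, m)) : u *m w = w + t *m w.
Proof. by rewrite mulmxDl mul1mx. Qed.

Lemma mulu0 m (w : 'M_(m, n)) : w *m u = 0 -> w *m t = w.
Proof. by rewrite mulu => h; rewrite -[RHS]addr0 -h addrA addmm add0r. Qed.

Lemma umul0 m (w : 'M_(n, m)) : u *m w = 0 -> t *m w = w.
Proof. by rewrite umul => h; rewrite -[RHS]addr0 -h addrA addmm add0r. Qed.

Lemma gen_t (a : lab) (w : 'rV_n) :
  (a = LH -> w *m u = 0) -> tm (modOf a) *m gen a t w = gen a t w *m t.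
Proof.
case: a => /= h.
- rewrite tF_block mul_block_col2 mul_col2 -mulmxA tt1.
  by rewrite !mul0mx !mul1mx mulmx1 add0r addr0.
- by rewrite mul1mx mulu0 ?h.
- by rewrite [LHS]flatmx0 [RHS]flatmx0.
Qed.

Lemma cogen_t (a : lab) (b : 'cV_n) :
  (a = LH -> u *m b = 0) -> t *m cogen a t b = cogen a t b *m tm (modOf a).
Proof.
case: a => /= h.
- rewrite tF_block mul_row2_block mul_row2 mulmxA tt1.
  by rewrite !mulmx0 !mulmx1 mul1mx add0r addr0.
- by rewrite mulmx1 umul0 ?h.
- by rewrite [LHS]thinmx0 [RHS]thinmx0.
Qed.

(** In the free case put y = w t b. Then w b = 1 + y, and the composite has rows (y, 1 + y) and (1 +
    y, y), a matrix of square 1 in characteristic 2. So only the pairing with w u matters. *)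
Lemma gen_cogen_unit (a : lab) (w : 'rV_n) (b : 'cV_n) :
  (a = LF -> w *m u *m b = 1%:M) -> (a = LH -> w *m b = 1%:M) ->
  gen a t w *m cogen a t b \in unitmx.
Proof.
case: a => /= hF hH; last 1 first.
- by rewrite unitmxE det_mx00 unitr1.
- have := hF erefl; rewrite mulu mulmxDl => e.
  rewrite mul_col2_row2 -!mulmxA (mulmxA t t) tt1 mul1mx.
  move: e; rewrite -mulmxA; set x := w *m b; set y := w *m _ => e.
  have {e} -> : x = 1%:M + y by rewrite -e -addrA addmm addr0.
  pose M : 'M['F_2]_2 := block_mx y (1%:M + y) (1%:M + y) y.
  suff /mulmx1_unit[] : M *m M = 1%:M by [].
  rewrite mulmx_block2 !mulmxDl !mulmxDr !mul1mx !mulmx1 block2_1.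
  have e1 : y *m y + (1%:M + y + (y + y *m y)) = 1%:M.
    by rewrite addrC addrA -!addrA !addmm addr0 !addrA -!addrA addmm addr0.
  have e2 : y + y *m y + (y + y *m y) = 0 by rewrite addmm.
  by rewrite e2 e1 [X in block_mx _ _ _ X]addrC e1.
- by rewrite hH // unitmx1.
Qed.

End Gen.

(** It suffices to compare both sides on the generator [w]: on [w t] they agree by equivariance. *)
Lemma gen_d (c : bool) (a a' : lab) n n' (t : 'M_n) (t' : 'M_n')
    (d : 'M_(n, n')) (w : 'rV_n) (w' : 'rV_n') :
  t' *m t' = 1%:M -> t *m d = d *m t' -> (a' = LH -> w' *m (1%:M + t') = 0) ->
  (a <> LZ -> w *m d = match a' with
     | LF => if labF c a then w' *m (1%:M + t') else w'
     | LH => w' | LZ => 0 end) ->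
  mT (lmor c a a') *m gen a' t' w' = gen a t w *m d.
Proof.
move=> tt1 td hw'; case: a => /= h; last by rewrite [LHS]flatmx0 [RHS]flatmx0.
- rewrite mul_col2 -mulmxA td mulmxA h // => {h}.
  case: a' hw' => /= hw'.
  + case: c => /=; last by rewrite mul1mx.
    rewrite const1_block mul_block_col2 !mul1mx mulu mulmxDl -mulmxA tt1 mulmx1.
    by rewrite [w' *m t' + _]addrC.
  + by rewrite const1_col mul_col2 !mul1mx (mulu0 (hw' erefl)).
  + by rewrite mul0mx mul0mx [RHS](@col_mx0 _ 1 1).
- rewrite h // => {h}.
  case: a' hw' => /= hw'; rewrite ?mul0mx ?mul1mx //.
  by rewrite /labF orbT const1_row mul_row2_col !mul1mx mulu.
Qed.

Lemma cogen_d (c : bool) (a a' : lab) n n' (t : 'M_n) (t' : 'M_n')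
    (d : 'M_(n, n')) (b : 'cV_n) (b' : 'cV_n') :
  t *m t = 1%:M -> t *m d = d *m t' -> (a = LH -> (1%:M + t) *m b = 0) ->
  (a' <> LZ -> d *m b' = match a with
     | LF => if labF c a' then (1%:M + t) *m b else b
     | LH => b | LZ => 0 end) ->
  d *m cogen a' t' b' = cogen a t b *m mT (lmor c a a').
Proof.
move=> tt1 td hb; case: a' => /= h; last by rewrite [LHS]thinmx0 [RHS]thinmx0.
- rewrite mul_row2 mulmxA -td -mulmxA h // => {h}.
  case: a hb => /= hb.
  + rewrite /labF orbF; case: c => /=; last by rewrite mulmx1.
    rewrite const1_block mul_row2_block !mulmx1 umul mulmxDr mulmxA tt1 mul1mx.
    by rewrite [b + _]addrC.
  + by rewrite const1_row mul_row2 !mulmx1 (umul0 (hb erefl)).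
  + by rewrite mulmx0 mulmx0 [LHS](@row_mx0 _ _ 1 1).
- rewrite h // => {h}.
  case: a hb => /= hb; rewrite ?mulmx0 ?mulmx1 //.
  by rewrite /labF orbT const1_col mul_row2_col !mulmx1 umul addrC.
Qed.

(** The conditions on [w] give a chain map into [V], those on [b] a chain map out of [V], and the
    last two make the composite invertible in each degree. *)
Lemma summand (V : tcx) (c : bool) (o : int -> lab) (n : int)
    (w : forall i, 'rV_(dm V i)) (b : forall i, 'cV_(dm V i)) :
  is_tcx V ->
  (forall i, o (i - n) = LH -> w i *m (1%:M + tt V i) = 0) ->
  (forall i, o (i - n) = LH -> (1%:M + tt V i) *m b i = 0) ->
  (forall i, o (i - n) <> LZ ->
     w i *m dd V i (i - 1) = match o (i - 1 - n) with
       | LF => if labF c (o (i - n)) then w (i - 1) *m (1%:M + tt V (i - 1))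
               else w (i - 1)
       | LH => w (i - 1) | LZ => 0 end) ->
  (forall i, o (i - 1 - n) <> LZ ->
     dd V i (i - 1) *m b (i - 1) = match o (i - n) with
       | LF => if labF c (o (i - 1 - n)) then (1%:M + tt V i) *m b i else b i
       | LH => b i | LZ => 0 end) ->
  (forall i, o (i - n) = LF -> w i *m (1%:M + tt V i) *m b i = 1%:M) ->
  (forall i, o (i - n) = LH -> w i *m b i = 1%:M) ->
  let P := theta (shift n (stdcx c o)) in
  exists W, [/\ is_tcx W, tcx_iso V (tsum P W)
              & forall i, dm V i = (dT (modOf (o (i - n)%R)) + dm W i)%N].
Proof.
move=> [V1 V2 V3 V4] w1 b1 w2 b2 nF nH P.
apply: (@tcx_split V P (fun i => gen (o (i - n)) (tt V i) (w i))
                       (fun i => cogen (o (i - n)) (tt V i) (b i))) => //.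
- split=> [i|i j]; first by apply: gen_t; [exact: V1|exact: w1].
  rewrite /= (_ : (j - n == i - n - 1) = (j == i - 1)); last by lia.
  case: eqP => [->|/eqP ij]; last by rewrite V3 // mul0mx mulmx0.
  by apply: gen_d; [exact: V1|exact: V2|exact: w1|exact: w2].
- split=> [i|i j]; first by apply: cogen_t; [exact: V1|exact: b1].
  rewrite /= (_ : (j - n == i - n - 1) = (j == i - 1)); last by lia.
  case: eqP => [->|/eqP ij]; last by rewrite V3 // mul0mx mulmx0.
  by apply: cogen_d; [exact: V1|exact: V2|exact: b1|exact: b2].
- by move=> i; apply: gen_cogen_unit; [exact: V1|exact: nF|exact: nH].
Qed.

(** * Updating families, and linear equations over a field *)

Lemma update (T : int -> Type) (f : forall i, T i) j (x : T j) :
  exists g : forall i, T i, g j = x /\ forall i, i != j -> g i = f i.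
Proof.
exists (dfwith f x); split; first exact: dfwith_in.
by move=> i ij; rewrite dfwith_out // eq_sym.
Qed.

(** The rows of [A *m pinvmx A - 1%:M] lie in the left kernel of [A], which kills [c]. *)
Lemma mulmx_solve (K : fieldType) m n p (A : 'M[K]_(m, n)) (c : 'M_(m, p)) :
  kermx A *m c = 0 -> exists z, A *m z = c.
Proof.
move=> hc; exists (pinvmx A *m c); apply/eqP.
rewrite -subr_eq0 mulmxA -{2}[c]mul1mx -mulmxBl.
have /submxP[x ->] : (A *m pinvmx A - 1%:M <= kermx A)%MS.
  by apply/sub_kermxP; rewrite mulmxBl mulmxKpV // mul1mx subrr.
by rewrite -mulmxA hc mulmx0.
Qed.

(** The kernel in the hypothesis is the preimage under [d] of the row space of [S]. A functional
    vanishing there factors through the quotient by [S]. *)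
Lemma functional_ext (K : fieldType) m n p q (d : 'M[K]_(m, n)) (S : 'M_(q, n))
    (c : 'M_(m, p)) :
  kermx (d *m cokermx S) *m c = 0 -> exists b, d *m b = c /\ S *m b = 0.
Proof.
move/mulmx_solve=> [z hz]; exists (cokermx S *m z).
by rewrite mulmxA hz mulmxA mulmx_coker mul0mx.
Qed.

Lemma row_functional (K : fieldType) n (w : 'rV[K]_n) :
  w != 0 -> exists b, w *m b = 1%:M.
Proof.
move=> w0; apply: mulmx_solve; rewrite mulmx1.
by apply/eqP; rewrite kermx_eq0 /row_free eqn_leq rank_leq_row lt0n mxrank_eq0.
Qed.

Lemma neq0_row (K : fieldType) m n p (A : 'M[K]_(m, n)) (B : 'M_(n, p)) :
  A *m B != 0 -> exists w : 'rV_n, (w <= A)%MS /\ w *m B != 0.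
Proof.
case/rowV0Pn => v /submxP[x ->] v0; exists (x *m A).
by rewrite submxMl -mulmxA.
Qed.

Lemma mx_dim0 (K : Type) m n (A B : 'M[K]_(m, n)) : m = 0%N -> A = B.
Proof. by move=> m0; apply/matrixP => i; move: (ltn_ord i); rewrite [ltnRHS]m0. Qed.

(** * Zigzags and dual zigzags *)

(* The labels of a zigzag in degrees [n, n - 1, ..., n - L] with top label [a] and
   bottom label [e]; [e] is ignored if [L = 0]. *)
Definition canon (n : int) (L : nat) (a e : lab) (i : int) : lab :=
  if i == n then a else if (n - L%:Z < i) && (i < n) then LF
  else if i == n - L%:Z then e else LZ.

Section Canon.
Variables (n : int) (L : nat) (a e : lab).

Lemma canon_top : canon n L a e n = a.
Proof. by rewrite /canon eqxx. Qed.

Lemma canon_bot : (0 < L)%N -> canon n L a e (n - L%:Z) = e.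
Proof. move=> L0; rewrite /canon ltxx eqxx; case: eqP => // h; exfalso; lia. Qed.

Lemma canon_mid j : n - L%:Z < j < n -> canon n L a e j = LF.
Proof. by move=> hj; rewrite /canon hj; case: eqP => // h; exfalso; lia. Qed.

End Canon.

Section Zigzag.
Variable V : tcx.
Hypothesis hV : is_tcx V.

Definition ut i : 'M_(dm V i) := 1%:M + tt V i.
Notation d i := (dd V i (i - 1)).

Lemma ut_dd i j : ut i *m dd V i j = dd V i j *m ut j.
Proof. by case: hV => _ V2 *; rewrite mulmxDl mulmxDr mul1mx mulmx1 V2. Qed.

(* [reach E f i] consists of the [v_i *m u] over all zigzags
   [v_i d = v_{i-1} u, v_{i-1} d = v_{i-2} u, ...] which after [f] steps land in
   [E]; [pre E f i] consists of the [v_i] of the zigzags with [f.+1] steps. *)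
Fixpoint reach (E : forall i, 'M_(dm V i)) f i : 'M_(dm V i) :=
  if f is f'.+1
  then kermx (d i *m cokermx (reach E f' (i - 1))) *m ut i
  else E i.

Definition pre E f i : 'M_(dm V i) := kermx (d i *m cokermx (reach E f (i - 1))).

Lemma sub_pre E f i (v : 'rV_(dm V i)) :
  (v <= pre E f i)%MS -> (v *m d i <= reach E f (i - 1))%MS.
Proof. by move/sub_kermxP; rewrite mulmxA submxE => ->. Qed.

(** The end condition is imposed in degree [i - f], where [V] is zero. *)
Lemma reach_stable E E' f i : dm V (i - f%:Z) = 0%N -> reach E f i = reach E' f i.
Proof.
elim: f i => [|f IH] i h /=.
  by apply: mx_dim0; rewrite -h subr0.
by rewrite (IH (i - 1)) // -h; congr dm; lia.
Qed.

(* [reach (stop false) f] describes the zigzags that die after [f] steps and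
   [reach (stop true) f] those that can be continued for [f] steps. *)
Definition stop (e : bool) i : 'M_(dm V i) := if e then ut i else 0.

Lemma chain e f i (x : 'rV_(dm V i)) : (x <= reach (stop e) f i)%MS ->
  exists w : forall j, 'rV_(dm V j),
  [/\ x = w i *m ut i,
      forall j, i - f%:Z < j <= i -> w j *m d j = w (j - 1) *m ut (j - 1)
    & ~~ e -> w (i - f%:Z) = 0].
Proof.
elim: f i x => [|f IH] i x /=.
  move=> hx; have [y [hy he]] : exists y, x = y *m ut i /\ (~~ e -> y = 0).
    move: hx; rewrite /stop; case: e => [/submxP[y ->]|]; first by exists y.
    by rewrite submx0 => /eqP->; exists 0; rewrite mul0mx.
  have [w [w1 w2]] := update (fun j => 0 : 'rV_(dm V j)) y.
  by exists w; split=> [|j|]; rewrite ?subr0 ?w1 //; lia.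
case/submxP=> y; rewrite mulmxA => ->.
have /sub_pre/IH[w [w1 w2 w3]] := submxMl y (pre (stop e) f i).
have [w' [w'1 w'2]] := update w (y *m pre (stop e) f i).
exists w'; split=> [|j hj|he].
- by rewrite w'1.
- have [->|ji] := eqVneq j i; first by rewrite w'1 w1 w'2 //; lia.
  by rewrite w'2 // w'2 ?w2 //; lia.
- have -> : i - f.+1%:Z = i - 1 - f%:Z by lia.
  by rewrite w'2 ?w3 //; lia.
Qed.

(** By [functional_ext], [c] extends to a functional [y] one degree lower that vanishes on [reach].
    One step further this says that [y] after u vanishes on [pre], so the construction repeats. *)
Lemma cochain E f i (c : 'cV_(dm V i)) : pre E f i *m c = 0 ->
  exists b : forall j, 'cV_(dm V j),
  [/\ d i *m b (i - 1) = c,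
      forall j, i - 1 - f%:Z < j <= i - 1 -> d j *m b (j - 1) = ut j *m b j
    & E (i - 1 - f%:Z) *m b (i - 1 - f%:Z) = 0].
Proof.
elim: f i c => [|f IH] i c /functional_ext[y [y1 y2]].
  have [b [b1 b2]] := update (fun j => 0 : 'cV_(dm V j)) y.
  by exists b; split=> [|j|]; rewrite ?subr0 ?b1 //; lia.
have /IH[b [b1 b2 b3]] : pre E f (i - 1) *m (ut (i - 1) *m y) = 0.
  by rewrite mulmxA.
have [b' [b'1 b'2]] := update b y.
exists b'; split=> [|j hj|].
- by rewrite b'1.
- have [->|ji] := eqVneq j (i - 1); first by rewrite b'1 b'2 ?b1 //; lia.
  by rewrite b'2 ?(b'2 j) ?b2 //; lia.
- have -> : i - 1 - f.+1%:Z = i - 1 - 1 - f%:Z by lia.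
  by rewrite b'2 ?b3 //; lia.
Qed.

(* The action linking a basis vector to its partner in the socle: [u] on a free
   summand, and [1] on a trivial one. *)
Definition lact (a : lab) i : 'M_(dm V i) :=
  match a with LF => ut i | LH => 1%:M | LZ => 0 end.

(** The hypotheses of [summand] in uniform shape: [lact] covers strings with u-arrows and also
    D(H). *)
Definition string_data (o : int -> lab)
    (w : forall i, 'rV_(dm V i)) (b : forall i, 'cV_(dm V i)) : Prop :=
  [/\ forall i, o i = LH -> w i *m ut i = 0,
      forall i, o i = LH -> ut i *m b i = 0,
      forall i, o i <> LZ -> w i *m d i = w (i - 1) *m lact (o (i - 1)) (i - 1),
      forall i, o (i - 1) <> LZ -> d i *m b (i - 1) = lact (o i) i *m b i
    & forall i, o i <> LZ -> w i *m lact (o i) i *m b i = 1%:M].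

Lemma string_dataI n L a e w b :
  a <> LZ -> e <> LZ -> (e = LH -> (0 < L)%N) ->
  (a = LH -> ut n = 0) -> dm V (n + 1) = 0%N ->
  (forall j, n - L%:Z < j <= n ->
    w j *m d j = w (j - 1) *m lact (canon n L a e (j - 1)) (j - 1)) ->
  (forall j, n - L%:Z < j <= n ->
    d j *m b (j - 1) = lact (canon n L a e j) j *m b j) ->
  (e = LF -> w (n - L%:Z) *m d (n - L%:Z) = 0) ->
  (e = LH -> ut (n - L%:Z) *m b (n - L%:Z) = 0) ->
  (forall i j, ut i *m dd V i j = 0) ->
  w n *m lact a n *m b n = 1%:M ->
  string_data (canon n L a e) w b.
Proof.
move=> a0 e0 eL ha hn hw hb we be ud nn.
have cZ j : canon n L a e j <> LZ -> n - L%:Z <= j <= n.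
  rewrite /canon; case: eqP => [->|_]; first by lia.
  by case: ifP => [? _|_]; first lia; case: eqP => // -> _; lia.
have cH j : canon n L a e j = LH ->
    j = n /\ a = LH \/ [/\ j = n - L%:Z, e = LH & (0 < L)%N].
  rewrite /canon; case: eqP => [->|_] h; first by left.
  by right; move: h; case: ifP => // _; case: eqP => // -> h; split=> //; exact: eL.
(* A bottom H is spanned by a boundary, so both u and d kill it. *)
have wd : e = LH -> exists x, w (n - L%:Z) = x *m dd V (n - L%:Z + 1) (n - L%:Z).
  move=> he; have L0 := eL he; exists (w (n - L%:Z + 1)).
  have := hw (n - L%:Z + 1); rewrite addrK canon_bot // he /= mulmx1 => -> //; lia.
split.
- move=> i /cH[[-> /ha->]|[-> he L0]]; first by rewrite mulmx0.
  by have [x ->] := wd he; rewrite -mulmxA -ut_dd ud mulmx0.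
- by move=> i /cH[[-> /ha->]|[-> he L0]]; [rewrite mul0mx|exact: be].
- move=> i /cZ hi.
  have [i1|i1] := eqVneq i (n - L%:Z); last by apply: hw; lia.
  have -> : canon n L a e (i - 1) = LZ.
    by case h: (canon _ _ _ _ _) => //; exfalso;
      have /cZ : canon n L a e (i - 1) <> LZ; rewrite ?h //; lia.
  rewrite mulmx0 i1; case: (e) e0 we wd => // _ we wd; first exact: we.
  by have [x ->] := wd erefl; case: hV => _ _ _ V4; rewrite -mulmxA V4 mulmx0.
- move=> i /cZ hi; have [i1|i1] := eqVneq i (n + 1); last by apply: hb; lia.
  by apply: mx_dim0; rewrite i1.
(* The pairing is constant along the string, since [w j *m d j *m b (j - 1)] computes it in degree j
   as well as in degree j - 1. *)
- suff H (k : nat) : (k <= L)%N -> w (n - k%:Z) *m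
      lact (canon n L a e (n - k%:Z)) (n - k%:Z) *m b (n - k%:Z) = 1%:M.
    move=> i /cZ hi; have [k [-> hk]] : exists k : nat, i = n - k%:Z /\ (k <= L)%N.
      by exists (absz (n - i)); lia.
    exact: H.
  elim: k => [|k IH] hk; first by rewrite subr0 canon_top.
  have -> : n - k.+1%:Z = n - k%:Z - 1 by lia.
  by rewrite -hw -?mulmxA ?hb ?mulmxA ?IH //; lia.
Qed.


End Zigzag.

Section ZigzagExists.
Variable V : tcx.
Hypothesis hV : is_tcx V.
Notation d i := (dd V i (i - 1)).
Notation ut := (ut V).

Lemma zigzag (n : int) (N : nat) :
  dm V n != 0%N -> dm V (n + 1) = 0%N ->
  (forall i, (N < absz i)%N -> dm V i = 0%N) ->
  (forall i j, ut i *m dd V i j = 0) ->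
  exists L a e w b, [/\ a <> LZ, e <> LZ, e = LH -> (0 < L)%N
    & @string_data V (canon n L a e) w b].
Proof.
move=> n0 n1 hN ud.
pose a := if ut n == 0 then LH else LF.
have a0 : a <> LZ by rewrite /a; case: ifP.
have aH : a = LH -> ut n = 0 by rewrite /a; case: eqP.
pose th := lact V a n.
have th0 : th != 0.
  rewrite /th /a; case: ifPn => //= _.
  by rewrite -mxrank_eq0 mxrank1.
(* So many steps lead below the support of [V], where surviving and dying zigzags are the same. *)
pose f0 := (absz n + N).+1.
have hf0 : dm V (n - 1 - f0%:Z) = 0%N by apply: hN; lia.
(* Some zigzag with [f.+1] steps and end condition [e] has a start not killed by [th]. *)
pose G e f := pre (stop V e) f n *m th != 0.
have [hG|hG] := boolP (G true f0).
  have hD : exists f, G false f.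
    exists f0; move: hG; rewrite /G /pre.
    by rewrite (@reach_stable V _ (stop V false)).
  (* A shortest dying zigzag, giving A_m or H(-m). *)
  case: (ex_minnP hD) => m /neq0_row[w0 [/sub_pre/chain[w [w1 w2 /(_ isT) w3]] w0n]] hm.
  have [w' [w'1 w'2]] := update w w0.
  have [bn hbn] := row_functional w0n.
  have hw j : n - 1 - m%:Z < j <= n -> w' j *m d j = w' (j - 1) *m ut (j - 1).
    move=> hj; have [->|jn] := eqVneq j n; first by rewrite w'1 w1 w'2 //; lia.
    by rewrite w'2 // w'2 ?w2 //; lia.
  have [b [b1 b2]] : exists b : forall j, 'cV_(dm V j), b n = bn /\
      forall j, n - m%:Z < j <= n ->
        d j *m b (j - 1) = lact V (canon n m a LF j) j *m b j.
    case: m hm {w1 w2 w3 hw} => [|m] hm.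
      have [b [b1 b2]] := update (fun j => 0 : 'cV_(dm V j)) bn.
      by exists b; split=> // j hj; exfalso; lia.
    (* By minimality no shorter dying zigzag has a start surviving [th], so the functional
       [th *m bn] vanishes on all those starts and extends downwards. *)
    have : pre (stop V false) m n *m (th *m bn) = 0.
      rewrite mulmxA; have [->|/hm] := eqVneq (pre (stop V false) m n *m th) 0.
        by rewrite mul0mx.
      by rewrite ltnn.
    move=> /cochain[b [c1 c2 _]].
    have [b' [b'1 b'2]] := update b bn.
    exists b'; split=> // j hj.
    have [->|jn] := eqVneq j n.
      by rewrite b'1 b'2 ?c1 ?canon_top //; lia.
    by rewrite b'2 ?(b'2 j) ?canon_mid ?c2 //; lia.
  exists m, a, LF, w', b; split=> //.
  apply: string_dataI => //.
  - move=> j hj; rewrite hw; last by lia.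
    have [->|jm] := eqVneq (j - 1) (n - m%:Z); last by rewrite canon_mid //; lia.
    by rewrite canon_bot //; lia.
  - move=> _; rewrite hw; last by lia.
    have -> : n - m%:Z - 1 = n - 1 - m%:Z by lia.
    by rewrite w'2 ?w3 ?mul0mx //; lia.
  - by rewrite w'1 b1.
have hD : exists f, ~~ G true f by exists f0.
(* Now [m] is the number of steps of a longest zigzag with nonzero [th] on its start. *)
case: (@ex_minnP (fun f => ~~ G true f) hD) => m /negPn/eqP hGm hm.
have [w [wn hw]] : exists w : forall j, 'rV_(dm V j), w n *m th != 0 /\
    forall j, n - m%:Z < j <= n -> w j *m d j = w (j - 1) *m ut (j - 1).
  case: m hm {hGm} => [|m] hm.
    have [w0 [_ hw0]] : exists w : 'rV_(dm V n), (w <= 1%:M)%MS /\ w *m th != 0.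
      by apply: neq0_row; rewrite mul1mx.
    have [w [w1 w2]] := update (fun j => 0 : 'rV_(dm V j)) w0.
    by exists w; rewrite w1; split=> // j hj; exfalso; lia.
  have /neq0_row[w0 [/sub_pre/chain[w [w1 w2 _]] w0n]] : G true m.
    by have [//|/hm] := boolP (G true m); rewrite ltnn.
  have [w' [w'1 w'2]] := update w w0.
  exists w'; rewrite w'1; split=> // j hj.
  have [->|jn] := eqVneq j n; first by rewrite w'1 w1 w'2 //; lia.
  by rewrite w'2 // w'2 ?w2 //; lia.
have [bn hbn] := row_functional wn.
have : pre (stop V true) m n *m (th *m bn) = 0 by rewrite mulmxA hGm mul0mx.
(* [c3] says that the last functional is killed by u, as a functional onto the bottom H must be. *)
move=> /cochain[b [c1 c2 c3]].
have [b' [b'1 b'2]] := update b bn.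
(* The boundary of the last vector is appended as the bottom H, one degree further down; hence the
   length [m.+1]. *)
have [w' [w'1 w'2]] := update w (w (n - m%:Z) *m d (n - m%:Z)).
have em : n - m.+1%:Z = n - m%:Z - 1 by lia.
exists m.+1, a, LH, w', b'; split=> //.
apply: string_dataI => //.
- move=> j hj.
  have [->|jm] := eqVneq j (n - m%:Z).
    by rewrite w'1 -em canon_bot // mulmx1 w'2 //; lia.
  by rewrite canon_mid ?w'2 ?hw //; lia.
- move=> j hj.
  have [->|jn] := eqVneq j n.
    by rewrite b'1 b'2 ?c1 ?canon_top //; lia.
  by rewrite b'2 ?(b'2 j) ?canon_mid ?c2 //; lia.
- move=> _; have -> : n - m.+1%:Z = n - 1 - m%:Z by lia.
  by rewrite b'2 //; lia.
- by rewrite b'1 w'2 //; lia.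
Qed.

(** The flag [c] affects only arrows between two copies of F; without F it may be false, as needed
    for D(H). *)
Lemma string_summand (c : bool) (o : int -> lab) (q : int -> lab) (sh : int) w b :
  (forall i, o (i - sh) = q i) -> @string_data V q w b ->
  c \/ (forall i, q i <> LF) ->
  exists W, [/\ is_tcx W, tcx_iso V (tsum (theta (shift sh (stdcx c o))) W)
              & forall i, dm V i = (dT (modOf (q i)) + dm W i)%N].
Proof.
move=> oq [s1 s2 s3 s4 s5] hc.
have nLF i : q i = LF -> c by case: hc => // h /h.
have [i|i|i|i|i|i|W [W1 W2 W3]] := @summand V c o sh w b hV; rewrite ?oq.
- exact: s1.
- exact: s2.
- move=> h; rewrite s3 // /labF; case e: (q (i - 1)) => /=.
  + by rewrite (nLF _ e).
  + by rewrite mulmx1.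
  + by rewrite mulmx0.
- move=> h; rewrite s4 // /labF; case e: (q i) => /=.
  + by rewrite (nLF _ e).
  + by rewrite mul1mx.
  + by rewrite mul0mx.
- by move=> h; have := s5 i; rewrite h; apply.
- by move=> h; have := s5 i; rewrite h /= mulmx1; apply.
- by exists W; split=> // i; rewrite W3 oq.
Qed.

End ZigzagExists.

(** * Splitting off one piece, and induction on the dimension *)

(** By the end labels (top, bottom): (F,F) is A_L, (F,H) is H(L), (H,F) is H(-L), and (H,H) is D(H)
    for L = 1 and B_{L-2} for larger L. *)
Lemma canon_piece (n : int) (L : nat) (a e : lab) :
  a <> LZ -> e <> LZ -> (e = LH -> (0 < L)%N) ->
  exists p sh c o, [/\ pieceCx p = stdcx c o,
    forall i, o (i - sh) = canon n L a e i
    & c \/ forall i, canon n L a e i <> LF].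
Proof.
move=> a0 e0 eL.
case: a a0 => // _; case: e e0 eL => // _ eL.
- exists (PA L), (n - L%:Z); do 2!eexists; split; [by []| |by left] => i.
  by rewrite /canon; repeat case: ifP => ?; first [by []|exfalso; lia].
- exists (PHn L%:Z), n; do 2!eexists; split; [by []| |by left] => i.
  have := eL erefl.
  by rewrite /canon; repeat case: ifP => ?; first [by []|move=> ?; exfalso; lia].
- exists (PHn (- L%:Z)), (n - L%:Z); do 2!eexists; split; [by []| |by left] => i.
  by rewrite /canon; repeat case: ifP => ?; first [by []|exfalso; lia].
- case: L {eL} (eL erefl) => [//|[|r]] _.
  + exists PDH, (n - 1); do 2!eexists; split; [by []|move=> i|right=> i];
    by rewrite /canon; repeat case: ifP => ?; first [by []|exfalso; lia].
  + exists (PB r), n; do 2!eexists; split; [by []| |by left] => i.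
    by rewrite /canon; repeat case: ifP => ?; first [by []|exfalso; lia].
Qed.

(** Take w with w u d nonzero and a functional b with w u d b = 1. The vectors w, w d and the
    covectors d b, b have pairing w u d b in both degrees, which makes the splitting of D(F)
    explicit. *)
Lemma square_summand (V : tcx) (i : int) :
  is_tcx V -> ut V i *m dd V i (i - 1) != 0 ->
  exists W, [/\ is_tcx W, tcx_iso V (tsum (theta (shift (i - 1) (cxD LF))) W)
    & forall j, dm V j =
        (dT (modOf (if ((j == i - 1) || (j == i))%R then LF else LZ)) + dm W j)%N].
Proof.
move=> hV; rewrite -[_ *m _]mul1mx => /neq0_row[w0 [_ hw0]].
have [bn hbn] := row_functional hw0.
have [w' [w'1 _]] := update (fun j => 0 : 'rV_(dm V j)) w0.
have [w [w1 w2]] := update w' (w0 *m dd V i (i - 1)).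
have {w'1} w3 : w i = w0 by rewrite w2 // ; lia.
have [b' [b'1 _]] := update (fun j => 0 : 'cV_(dm V j)) bn.
have [b [b1 b2]] := update b' (dd V i (i - 1) *m bn).
have {b'1} b3 : b (i - 1) = bn by rewrite b2 //; lia.
pose q (j : int) := if (j == i - 1) || (j == i) then LF else LZ.
pose o (j : int) := if (j == 0) || (j == 1) then LF else LZ.
have oq j : o (j - (i - 1)) = q j.
  by rewrite /o /q; repeat case: ifP => ?; first [by []|exfalso; lia].
have qH j : q j <> LH by rewrite /q; case: ifP.
have qZ j : q j <> LZ -> j = i \/ j = i - 1.
  by rewrite /q; case: ifP => // /orP[]/eqP; auto.
have q1 : q i = LF by rewrite /q eqxx orbT.
have q2 : q (i - 1) = LF by rewrite /q eqxx.
have q3 : q (i - 1 - 1) = LZ by rewrite /q; case: ifP => // ?; exfalso; lia.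
have q4 : q (i + 1) = LZ by rewrite /q; case: ifP => // ?; exfalso; lia.
have dd0 j k l : dd V j k *m dd V k l = 0 by case: hV.
have [j|j|j|j|j|j|W [W1 W2 W3]] := @summand V false o (i - 1) w b hV; rewrite ?oq.
- by move/qH.
- by move/qH.
- case/qZ => ->; first by rewrite q1 q2 w3 w1.
  by rewrite q2 q3 w1 -mulmxA dd0 mulmx0.
- case/qZ => [ej|/addIr->]; last by rewrite q1 q2 b3 b1.
  have -> : j = i + 1 by lia.
  by rewrite addrK q4 b1 mulmxA dd0 mul0mx.
- move=> h; have /qZ[->|->] : q j <> LZ by rewrite h.
    by rewrite w3 b1 -hbn -[1%:M + _]/(ut V i) !mulmxA.
  by rewrite w1 b3 -hbn -[1%:M + _]/(ut V (i - 1)) (ut_dd hV i) !mulmxA.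
- by move/qH.
- by exists W; split=> // j; rewrite W3 oq.
Qed.

(** The degreewise bound keeps the support within the same range; strictness somewhere makes the
    induction terminate. *)
Definition dim_below (W V : tcx) : Prop :=
  (forall i, (dm W i <= dm V i)%N) /\ exists i, (dm W i < dm V i)%N.

Lemma tcx_piece (V : tcx) (N : nat) :
  is_tcx V -> (forall i, (N < absz i)%N -> dm V i = 0%N) ->
  (exists i, dm V i <> 0%N) ->
  exists p sh W, [/\ is_tcx W, dim_below W V
    & tcx_iso V (tsum (theta (shift sh (pieceCx p))) W)].
Proof.
move=> hV hN [i0 hi0].
(* A finite index for the degrees from -N to N makes it decidable whether u d vanishes
   everywhere. *)
pose I (k : 'I_(N + N).+1) : int := k%:Z - N%:Z.
have inI i : dm V i <> 0%N -> exists k, i = I k.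
  move=> hi; have hk : (absz (i + N%:Z)%R < (N + N).+1)%N.
    by case: (leqP (absz i) N) => [|/hN //]; lia.
  exists (Ordinal hk); rewrite /I /=.
  by case: (leqP (absz i) N) => [|/hN //]; lia.
have below (W : tcx) q : (forall j, dm V j = (dT (modOf (q j)) + dm W j)%N) ->
    (exists j, q j <> LZ) -> dim_below W V.
  move=> h [j hj]; split=> [k|]; first by rewrite h leq_addl.
  by exists j; rewrite h; case: (q j) hj => //= _; rewrite ltnS ?leqnSn.
have [/existsP[k hk]|/existsPn hud] :=
    boolP [exists k, ut V (I k) *m dd V (I k) (I k - 1) != 0].
  have [W [W1 W2 W3]] := square_summand hV hk.
  exists PDF, (I k - 1), W; split=> //.
  by apply: (below _ _ W3); exists (I k); rewrite eqxx orbT.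
have ud i j : ut V i *m dd V i j = 0.
  have [->|ij] := eqVneq j (i - 1); last by case: hV => _ _ -> //; rewrite mulmx0.
  have [i1|/eqP/inI[k ->]] := eqVneq (dm V i) 0%N; first exact: mx_dim0.
  by apply/eqP; have := hud k; rewrite negbK.
have [k0 ek0] := inI _ hi0.
have hex : exists k : nat, dm V (k%:Z - N%:Z) != 0%N.
  by exists k0; apply/eqP; rewrite -[_ - _]/(I k0) -ek0.
have hub (k : nat) : dm V (k%:Z - N%:Z) != 0%N -> (k <= N + N)%N.
  by case: (leqP k (N + N)) => // hk /eqP[]; apply: hN; lia.
(* The top nonzero degree is [m - N]. *)
case: (ex_maxnP hex hub) => m hm hmax.
have n1 : dm V (m%:Z - N%:Z + 1) = 0%N.
  apply/eqP/negPn/negP => h; have := hmax m.+1.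
  have -> : m.+1%:Z - N%:Z = m%:Z - N%:Z + 1 by lia.
  by move/(_ h); rewrite ltnn.
have [L [a [e [w [b [a0 e0 eL hs]]]]]] := zigzag hV hm n1 hN ud.
have [p [sh [c [o [ep oq hc]]]]] := canon_piece (m%:Z - N%:Z) a0 e0 eL.
have [W [W1 W2 W3]] := string_summand hV oq hs hc.
exists p, sh, W; rewrite ep; split=> //.
by apply: (below _ _ W3); exists (m%:Z - N%:Z); rewrite canon_top.
Qed.

Lemma tcx_decomposition (V : tcx) (N : nat) :
  is_tcx V -> (forall i, (N < absz i)%N -> dm V i = 0%N) ->
  exists s : seq (piece * int),
    tcx_iso V (theta (cxbig [seq shift x.2 (pieceCx x.1) | x <- s])).
Proof.
pose size V := (\sum_(k < (N + N).+1) dm V (k%:Z - N%:Z)%R)%N.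
have [k] := ubnP (size V); elim: k V => // k IH V hk hV hN.
have [h0|/forallPn[j hj]] := boolP [forall k : 'I_(N + N).+1, dm V (k%:Z - N%:Z) == 0%N].
  have z i : dm V i = 0%N.
    case: (leqP (absz i) N) => [hi|/hN //].
    have hl : (absz (i + N%:Z)%R < (N + N).+1)%N by lia.
    have /forallP/(_ (Ordinal hl))/eqP /= := h0.
    by have -> : (absz (i + N%:Z)%R)%:Z - N%:Z = i by lia.
  exists [::], (fun _ => 0), (fun _ => 0).
  by split=> [||i|i]; try split=> *; try (exact: mx_dim0).
have [|p [sh [W [W1 [W2 [i hi]] W3]]]] := tcx_piece hV hN.
  by exists (j%:Z - N%:Z); apply/eqP.
have sizeW : (size W < size V)%N.
  have hl : (absz (i + N%:Z)%R < (N + N).+1)%N.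
    by case: (leqP (absz i) N) => [|/hN h]; [lia|rewrite h in hi].
  rewrite /size (bigD1 (Ordinal hl)) //= [ltnRHS](bigD1 (Ordinal hl)) //=.
  have -> : (absz (i + N%:Z)%R)%:Z - N%:Z = i.
    by case: (leqP (absz i) N) => [|/hN h]; [lia|rewrite h in hi].
  by rewrite -addSn leq_add // leq_sum.
have [||s hs] := IH W _ W1.
- exact: leq_trans sizeW _.
- by move=> l /hN h; apply/eqP; rewrite -leqn0 -h.
exists ((p, sh) :: s).
exact: tcx_iso_trans W3 (tcx_iso_sum _ hs).
Qed.

Lemma is_tcx_theta (C : cx) : is_cx C -> is_tcx (theta C).
Proof.
move=> [C1 C2 C3 C4]; split=> [i|i j|i j|i j k] /=.
- by case: (C1 i).
- by case: (C2 i j).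
- by move/C3->.
- by have := C4 i j k => -[].
Qed.

Theorem theorem4p5 (C : cx) :
  is_cx C -> bounded C ->
  (forall i : int, exists s : seq bool, mod_iso (obj C i) (FHsum s)) ->
  exists s : seq (piece * int),
    cx_iso C (cxbig [seq shift x.2 (pieceCx x.1) | x <- s]).
Proof.
move=> hC [N hN] hs.
have [|s hiso] := @tcx_decomposition (theta C) N (is_tcx_theta hC).
  by move=> i /hN[].
(* Both complexes consist of fixed-point modules, so the isomorphism of Theta parts lifts. *)
exists s; apply: cx_iso_theta hiso; last exact: cx_fixed_big.
case: hC => C1 C2 _ _; split=> // i.
by have [t ht] := hs i; exact: fixed_iso ht (fixed_FHsum t).
Qed.
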